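(* Let $M$ be a smooth manifold with an affine connection (covariant differentiation) $\nabla$, curvature operator $R$ and torsion $T$. For all smooth vector fields $A,B,C,D$ on $M$, $$\bigl\{(\nabla_{[A,B]_-}R)(C,D)+(\nabla_AR)(B,[C,D]_-)+(\nabla_AR)([B,C]_-,D)-R(A,T(B,[C,D]_-))-R(A,T([B,C]_-,D))+R(T(A,B),[C,D]_-)\bigr\}_{<A,B,C,D>}=0 .$$
   Context: For vector fields $A,B$ put $[A,B]_-:=A\circ B-B\circ A$, $R(A,B):=\nabla_A\circ\nabla_B-\nabla_B\circ\nabla_A-\nabla_{[A,B]_-}$ and $T(A,B):=\nabla_AB-\nabla_BA-[A,B]_-$. The covariant derivative of the curvature is $(\nabla_AR)(B,C)=\nabla_A\circ R(B,C)-R(B,C)\circ\nabla_A-R(\nabla_AB,C)-R(B,\nabla_AC)$. The notation $\{\ldots\}_{<A,B,C,D>}$ means the sum of the four expressions obtained from $\{\ldots\}$ by the cyclic permutations of $(A,B,C,D)$. *)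

(* Defs.v *)
From HB Require Import structures.
From mathcomp Require Import all_boot all_order all_algebra.
From mathcomp Require Import all_classical all_reals all_analysis.
From mathcomp Require Import ring.

Set Implicit Arguments.
Unset Strict Implicit.
Unset Printing Implicit Defensive.

Import Order.TTheory GRing.Theory Num.Theory.
Import numFieldNormedType.Exports.

Local Open Scope classical_set_scope.
Local Open Scope ring_scope.

(* C^k on an open subset U of R^n, through the partial derivatives            *)
(* 'D_(delta_mx 0 i) f.  Only meaningful when U is open: every notion below   *)
(* looks at f on a neighbourhood of the points of U.                          *)
Fixpoint Ck_on (R : realType) (n : nat) (W : normedModType R) (k : nat)
    (U : set 'rV[R]_n) (f : 'rV[R]_n -> W) : Prop :=
  (forall x, U x -> {for x, continuous f}) /\
  match k with
  | 0 => True
  | k'.+1 => forall i : 'I_n,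
      (forall x, U x -> derivable f x (delta_mx 0 i)) /\
      Ck_on k' U (fun x => 'D_(delta_mx 0 i) f x)
  end.

Definition smooth_on (R : realType) (n : nat) (W : normedModType R)
    (U : set 'rV[R]_n) (f : 'rV[R]_n -> W) : Prop :=
  forall k, Ck_on k U f.

Section Ck_closure.
Variables (R : realType) (n : nat).
Implicit Types (U : set 'rV[R]_n) (k : nat) (f g : 'rV[R]_n -> R).

Lemma near_eq_continuous U f g x : open U -> (forall y, U y -> f y = g y) ->
  U x -> {for x, continuous f} -> {for x, continuous g}.
Proof.
move=> oU fg Ux cf; rewrite /prop_for /continuous_at -(fg x Ux).
have nfg : \forall y \near x, f y = g y.
  have := open_nbhs_nbhs (conj oU Ux : open_nbhs x U).
  by apply: filterS => y /fg.
exact: cvg_trans (near_eq_cvg nfg) cf.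
Qed.

Lemma Ck_on_eq k U f g : open U -> (forall x, U x -> f x = g x) ->
  Ck_on k U f -> Ck_on k U g.
Proof.
move=> oU; elim: k f g => [|k IH] f g fg [cf df].
  by split=> // x Ux; apply: (near_eq_continuous oU fg Ux); exact: cf.
have nfg x : U x -> \forall y \near x, f y = g y.
  move=> Ux; have := open_nbhs_nbhs (conj oU Ux : open_nbhs x U).
  by apply: filterS => y /fg.
split=> [x Ux|i]; first by apply: (near_eq_continuous oU fg Ux); exact: cf.
have [df1 df2] := df i; split=> [x Ux|].
  exact: (near_eq_derivable (nfg x Ux)) (df1 x Ux).
by apply: IH df2 => x Ux; apply: near_eq_derive; exact: nfg.
Qed.

Lemma Ck_onS k U f : Ck_on k.+1 U f -> Ck_on k U f.
Proof.
elim: k f => [|k IH] f [cf df]; first by split.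
split=> // i; have [df1 df2] := df i; split=> //; exact: IH.
Qed.

Lemma Ck_on_cst k U (a : R) : Ck_on k U (fun=> a).
Proof.
elim: k a => [|k IH] a; first by split=> // x _; exact: cst_continuous.
split=> [x _|i]; first exact: cst_continuous.
split=> [x _|]; first exact: derivable_cst.
have -> : (fun x : 'rV[R]_n => 'D_(delta_mx 0 i) (fun=> a) x) = fun=> 0 :> R.
  by apply/funext => x; rewrite derive_cst.
exact: IH.
Qed.

Lemma Ck_onD k U f g : open U -> Ck_on k U f -> Ck_on k U g ->
  Ck_on k U (f + g).
Proof.
move=> oU; elim: k f g => [|k IH] f g [cf df] [cg dg].
  by split=> // x Ux; apply: continuousD; [exact: cf|exact: cg].
split=> [x Ux|i]; first by apply: continuousD; [exact: cf|exact: cg].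
have [df1 df2] := df i; have [dg1 dg2] := dg i.
split=> [x Ux|]; first by apply: derivableD; [exact: df1|exact: dg1].
apply: Ck_on_eq (IH _ _ df2 dg2) => // x Ux.
by rewrite deriveD //; [exact: df1|exact: dg1].
Qed.

Lemma Ck_onM k U f g : open U -> Ck_on k U f -> Ck_on k U g ->
  Ck_on k U (f * g).
Proof.
move=> oU; elim: k f g => [|k IH] f g Cf Cg.
  case: Cf Cg => [cf _] [cg _].
  by split=> // x Ux; apply: continuousM; [exact: cf|exact: cg].
have [cf df] := Cf; have [cg dg] := Cg.
split=> [x Ux|i]; first by apply: continuousM; [exact: cf|exact: cg].
have [df1 df2] := df i; have [dg1 dg2] := dg i.
split=> [x Ux|]; first by apply: derivableM; [exact: df1|exact: dg1].
apply: Ck_on_eq (Ck_onD oU (IH _ _ (Ck_onS Cf) dg2)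
  (IH _ _ (Ck_onS Cg) df2)) => // x Ux.
by rewrite deriveM //; [exact: df1|exact: dg1].
Qed.

End Ck_closure.

(* A homeomorphism from an open subset of T onto an open subset of R^n, with  *)
(* its inverse; outside of these two sets the values of the maps are junk.    *)
Record chart (R : realType) (n : nat) (T : topologicalType) := Chart {
  chart_dom : set T;
  chart_img : set 'rV[R]_n;
  chart_map : T -> 'rV[R]_n;
  chart_inv : 'rV[R]_n -> T;
  chart_dom_open : open chart_dom;
  chart_img_open : open chart_img;
  chart_mapP : forall p, chart_dom p -> chart_img (chart_map p);
  chart_invP : forall x, chart_img x -> chart_dom (chart_inv x);
  chart_mapK : forall p, chart_dom p -> chart_inv (chart_map p) = p;
  chart_invK : forall x, chart_img x -> chart_map (chart_inv x) = x;
  chart_map_cont : {within chart_dom, continuous chart_map};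
  chart_inv_cont : {within chart_img, continuous chart_inv}
}.

(* The atlas need not be maximal. *)
Record smoothManifold (R : realType) (n : nat) := SmoothManifold {
  manifold_sort :> topologicalType;
  manifold_hausdorff : hausdorff_space manifold_sort;
  manifold_second_countable : @second_countable manifold_sort;
  atlas : set (chart R n manifold_sort);
  atlas_cover : forall p, exists2 c, atlas c & chart_dom c p;
  atlas_compat : forall c d, atlas c -> atlas d ->
    smooth_on (chart_img c `&` chart_inv c @^-1` chart_dom d)
              (chart_map d \o chart_inv c)
}.

Definition smooth (R : realType) (n : nat) (M : smoothManifold R n)
    (f : M -> R) : Prop :=
  forall c, atlas c -> smooth_on (chart_img c) (f \o chart_inv c).

Definition smooth_pred (R : realType) (n : nat) (M : smoothManifold R n) :
    {pred M -> R} := mem [set f | smooth f].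
Arguments smooth_pred {R n} M.

Section smooth_functions.
Variables (R : realType) (n : nat) (M : smoothManifold R n).

Lemma smooth_cst (a : R) : (cst a : M -> R) \in smooth_pred M.
Proof. by rewrite inE => c _ k; exact: Ck_on_cst. Qed.

Lemma smooth_subring_closed : subring_closed (smooth_pred M).
Proof.
have sM f g : f \in smooth_pred M -> g \in smooth_pred M ->
    f * g \in smooth_pred M.
  rewrite !inE => sf sg c ac k.
  by apply: Ck_onM; [exact: chart_img_open|exact: sf|exact: sg].
split=> //; first exact: smooth_cst.
move=> f g sf sg.
have : (cst (-1) : M -> R) * g \in smooth_pred M by exact: sM (smooth_cst _) sg.
have -> : (cst (-1) : M -> R) * g = - g.
  by apply/funext => p; rewrite /GRing.mul /= mulN1r.
move: sf; rewrite !inE => sf sg' c ac k.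
by apply: Ck_onD; [exact: chart_img_open|exact: sf|exact: sg'].
Qed.

HB.instance Definition _ :=
  GRing.isSubringClosed.Build (M -> R) (smooth_pred M) smooth_subring_closed.

Record smoothFun := SmoothFun {
  smoothFun_val :> M -> R;
  smoothFunP : smoothFun_val \in smooth_pred M
}.

HB.instance Definition _ := [isSub for smoothFun_val].
HB.instance Definition _ := [Choice of smoothFun by <:].
HB.instance Definition _ :=
  GRing.SubChoice_isSubComPzRing.Build (M -> R) (smooth_pred M) smoothFun
    smooth_subring_closed.

Definition smooth_const (a : R) : smoothFun := SmoothFun (smooth_cst a).

Definition smoothFun_scale (a : R) (f : smoothFun) : smoothFun :=
  smooth_const a * f.

Lemma smoothFun_scaleA a b f :
  smoothFun_scale a (smoothFun_scale b f) = smoothFun_scale (a * b) f.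
Proof. by apply/val_inj/funext => p; exact: mulrA. Qed.

Lemma smoothFun_scale1 : left_id 1 smoothFun_scale.
Proof. by move=> f; apply/val_inj/funext => p; exact: mul1r. Qed.

Lemma smoothFun_scaleDr : right_distributive smoothFun_scale +%R.
Proof. by move=> a f g; apply/val_inj/funext => p; exact: mulrDr. Qed.

Lemma smoothFun_scaleDl f : {morph smoothFun_scale^~ f : a b / a + b}.
Proof. by move=> a b; apply/val_inj/funext => p; exact: mulrDl. Qed.

HB.instance Definition _ := GRing.Zmodule_isLmodule.Build R smoothFun
  smoothFun_scaleA smoothFun_scale1 smoothFun_scaleDr smoothFun_scaleDl.

(* Smooth vector fields are the R-linear derivations of C^oo(M); the tangent  *)
(* vector at p of the field X is the point derivation f |-> X f p.            *)
Definition derivation (X : smoothFun -> smoothFun) : Prop :=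
  (forall (a : R) f g, X (a *: f + g) = a *: X f + X g) /\
  (forall f g, X (f * g) = X f * g + f * X g).

(* Codomain C^oo(M) as a module over itself, so that functions into it can be *)
(* multiplied by elements of C^oo(M).                                         *)
Definition derivation_pred : {pred smoothFun -> smoothFun^o} :=
  mem [set X | derivation X].

Lemma derivation_submod_closed : submod_closed derivation_pred.
Proof.
split=> [|h X Y].
  rewrite inE; split=> [a f g|f g].
    by rewrite [LHS]/(0 : smoothFun) scaler0 addr0.
  by rewrite [LHS]/(0 : smoothFun) mul0r mulr0 addr0.
rewrite !inE => -[Xl XM] [Yl YM].
have E f : (h *: X + Y) f = h * X f + Y f by [].
split=> [a f g|f g]; rewrite !E.
  rewrite Xl Yl scalerDr mulrDr -!addrA; congr (_ + _); last first.
    by rewrite addrCA.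
  by apply/val_inj/funext => p; exact: mulrCA.
rewrite XM YM !mulrDr !mulrDl !mulrA (mulrC f h) -!addrA; congr (_ + _).
by rewrite addrCA.
Qed.

HB.instance Definition _ := GRing.isSubmodClosed.Build smoothFun
  (smoothFun -> smoothFun^o) derivation_pred derivation_submod_closed.

Record vectorField := VectorField {
  vectorField_val :> smoothFun -> smoothFun^o;
  vectorFieldP : vectorField_val \in derivation_pred
}.

HB.instance Definition _ := [isSub for vectorField_val].
HB.instance Definition _ := [Choice of vectorField by <:].
HB.instance Definition _ :=
  GRing.SubChoice_isSubLmodule.Build smoothFun (smoothFun -> smoothFun^o)
    derivation_pred vectorField derivation_submod_closed.

Lemma lie_bracket_derivation (A B : vectorField) :
  ((A \o B) - (B \o A) : smoothFun -> smoothFun^o) \in derivation_pred.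
Proof.
case: A B => A PA [B PB] /=; move: PA PB; rewrite !inE => -[Al AM] [Bl BM].
have AD f g : A (f + g) = A f + A g by have := Al 1 f g; rewrite !scale1r.
have BD f g : B (f + g) = B f + B g by have := Bl 1 f g; rewrite !scale1r.
pose E (f : smoothFun) : smoothFun := A (B f) - B (A f).
suff : derivation E by [].
split=> [a f g|f g]; rewrite /E.
  rewrite Bl Al Al Bl scalerBr opprD -!addrA; congr (_ + _).
  by rewrite addrCA.
rewrite BM AM AD BD !AM !BM.
ring.
Qed.

Definition lie_bracket (A B : vectorField) : vectorField :=
  VectorField (lie_bracket_derivation A B).

End smooth_functions.

(* R-linearity in the second argument follows from additivity and the Leibniz *)
(* rule applied to constant functions.                                        *)
Record affineConnection (R : realType) (n : nat) (M : smoothManifold R n) :=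
  AffineConnection {
  cov :> vectorField M -> vectorField M -> vectorField M;
  cov_addl : forall A A' B, cov (A + A') B = cov A B + cov A' B;
  cov_scalel : forall (f : smoothFun M) A B, cov (f *: A) B = f *: cov A B;
  cov_addr : forall A B B', cov A (B + B') = cov A B + cov A B';
  cov_leibniz : forall A (f : smoothFun M) B,
    cov A (f *: B) = (A f : smoothFun M) *: B + f *: cov A B
}.

Section curvature.
Variables (R : realType) (n : nat) (M : smoothManifold R n).
Variable nabla : affineConnection M.
Implicit Types A B C : vectorField M.

Definition torsion A B : vectorField M :=
  nabla A B - nabla B A - lie_bracket A B.

Definition curvature A B : vectorField M -> vectorField M :=
  (nabla A \o nabla B) - (nabla B \o nabla A) - nabla (lie_bracket A B).

Definition cov_curvature A B C : vectorField M -> vectorField M :=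
  (nabla A \o curvature B C) - (curvature B C \o nabla A)
  - curvature (nabla A B) C - curvature B (nabla A C).

End curvature.

Definition cyclic_sum4 (X : Type) (V : zmodType) (F : X -> X -> X -> X -> V)
    (a b c d : X) : V :=
  F a b c d + F b c d a + F c d a b + F d a b c.

(* Main.v *)
(** The identity is a cyclic sum of second Bianchi identities: for a connection
    with torsion, (nabla_X R)(Y,Z) + R(T(X,Y),Z) summed over the cyclic
    permutations of (X,Y,Z) vanishes.  Applying this to the triples
    ([A,B],C,D), ([B,C],D,A), ([C,D],A,B), ([D,A],B,C) and adding up gives, after
    reindexing each of the six terms by a rotation of (A,B,C,D), the claim. *)
Require Import Defs.
From HB Require Import structures.
From mathcomp Require Import all_boot all_order all_algebra.
From mathcomp Require Import all_classical all_reals all_analysis.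

Local Open Scope ring_scope.
Import GRing.Theory.

Set Implicit Arguments.
Unset Strict Implicit.
Unset Printing Implicit Defensive.

(** * Cyclic sums: rotation and telescoping *)

Section cyclic_sums.
Variables (X : Type) (V : zmodType).
Implicit Types (F G : X -> X -> X -> X -> V) (H K : X -> X -> X -> V).

Lemma cyclic_sum4D F G a b c d :
  cyclic_sum4 (fun a b c d => F a b c d + G a b c d) a b c d =
  cyclic_sum4 F a b c d + cyclic_sum4 G a b c d.
Proof. by rewrite /cyclic_sum4; do 3![rewrite [RHS]addrACA; congr (_ + _)]. Qed.

Lemma cyclic_sum4_rot F a b c d :
  cyclic_sum4 (fun a b c d => F b c d a) a b c d = cyclic_sum4 F a b c d.
Proof. by rewrite /cyclic_sum4 addrC !addrA. Qed.

Lemma cyclic_sum4_rot2 F a b c d :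
  cyclic_sum4 (fun a b c d => F c d a b) a b c d = cyclic_sum4 F a b c d.
Proof.
by rewrite -(cyclic_sum4_rot F) -(cyclic_sum4_rot (fun a b c d => F b c d a)).
Qed.

Lemma cyclic_sum4_rot3 F a b c d :
  cyclic_sum4 (fun a b c d => F d a b c) a b c d = cyclic_sum4 F a b c d.
Proof. by rewrite -(cyclic_sum4_rot (fun a b c d => F d a b c)). Qed.

Lemma eq_cyclic_sum4 F G a b c d :
  (forall a b c d, F a b c d = G a b c d) ->
  cyclic_sum4 F a b c d = cyclic_sum4 G a b c d.
Proof. by move=> FG; rewrite /cyclic_sum4 !FG. Qed.

Definition cyclic_sum3 H a b c : V := H a b c + H b c a + H c a b.

Lemma cyclic_sum3D H K a b c :
  cyclic_sum3 (fun a b c => H a b c + K a b c) a b c =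
  cyclic_sum3 H a b c + cyclic_sum3 K a b c.
Proof. by rewrite /cyclic_sum3; do 2![rewrite [RHS]addrACA; congr (_ + _)]. Qed.

(** Telescoping around the cycle. The Jacobi and Bianchi identities below are reduced to summands of
    this shape. *)
Lemma cyclic_sum3_rotB H a b c :
  cyclic_sum3 (fun a b c => H a b c - H b c a) a b c = 0.
Proof. by rewrite /cyclic_sum3 !addrA !subrK subrr. Qed.

Lemma eq_cyclic_sum3 H K a b c :
  (forall a b c, H a b c = K a b c) ->
  cyclic_sum3 H a b c = cyclic_sum3 K a b c.
Proof. by move=> HK; rewrite /cyclic_sum3 !HK. Qed.

End cyclic_sums.

(** * Commutators and the Jacobi identity *)

Section commutator.
Variable V : zmodType.
Implicit Types (f g h : {additive V -> V}) (u v : V -> V).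

(** Taken on bare functions, since [curvature nabla B C] carries no additive structure. *)
Definition commutator u v : V -> V := (u \o v) - (v \o u).

Lemma commutatorN u v : commutator v u = - commutator u v.
Proof. by rewrite /commutator opprB. Qed.

(** Only [f] has to be additive: precomposing [u - v] with [f] distributes pointwise. *)
Lemma commutatorBr f u v :
  commutator f (u - v) = commutator f u - commutator f v.
Proof.
apply/funext => x.
change (f (u x - v x) - (u (f x) - v (f x)) =
        f (u x) - u (f x) - (f (v x) - v (f x))).
by rewrite raddfB !opprD addrACA.
Qed.

Lemma commutator_jacobi f g h :
  cyclic_sum3 (fun f g h : {additive V -> V} =>
    commutator f (commutator g h)) f g h = 0.
Proof.
(* Of the four products in a double commutator, two differ by a rotation of [H] and two by a
   rotation of [K]. *)
pose H f g h : V -> V := f \o g \o h.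
pose K f g h : V -> V := h \o g \o f.
under eq_cyclic_sum3 => f1 f2 f3.
  have -> : commutator f1 (commutator f2 f3) =
      (H f1 f2 f3 - H f2 f3 f1) + (K f1 f2 f3 - K f2 f3 f1).
    apply/funext => x.
    change (f1 (f2 (f3 x) - f3 (f2 x)) - (f2 (f3 (f1 x)) - f3 (f2 (f1 x))) =
      f1 (f2 (f3 x)) - f2 (f3 (f1 x)) + (f3 (f2 (f1 x)) - f1 (f3 (f2 x)))).
    by rewrite raddfB opprD opprK addrACA; congr (_ + _); rewrite addrC.
  over.
by rewrite cyclic_sum3D !cyclic_sum3_rotB addr0.
Qed.

End commutator.

(** * The second Bianchi identity with torsion *)

Section second_bianchi.
Variables (R : realType) (n : nat) (M : smoothManifold R n).
Variable nabla : affineConnection M.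
Implicit Types A B C X : vectorField M.

(** Makes the commutator lemmas applicable to derivations; the next fact does the same for
    [nabla A]. *)
Fact vectorField_zmod_morphism A : zmod_morphism (A : smoothFun M -> smoothFun M).
Proof.
move=> f g; have := vectorFieldP A; rewrite inE => -[Al _].
by rewrite addrC -scaleN1r Al scaleN1r addrC.
Qed.

HB.instance Definition _ A :=
  GRing.isZmodMorphism.Build (smoothFun M) (smoothFun M) (vectorField_val A)
    (vectorField_zmod_morphism A).

Fact cov_zmod_morphism A : zmod_morphism (nabla A).
Proof. by move=> B C; apply/eqP; rewrite eq_sym subr_eq -cov_addr subrK. Qed.

HB.instance Definition _ A :=
  GRing.isZmodMorphism.Build (vectorField M) (vectorField M) (nabla A)
    (cov_zmod_morphism A).

Lemma covDl A B : nabla (A + B) = nabla A + nabla B.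
Proof. by apply/funext => X; exact: cov_addl. Qed.

Lemma covBl A B : nabla (A - B) = nabla A - nabla B.
Proof. by apply/eqP; rewrite eq_sym subr_eq -covDl subrK. Qed.

Lemma cov0l : nabla 0 = 0.
Proof. by rewrite -(subrr 0) covBl subrr. Qed.

(** The map underlying a Lie bracket is convertible to a [commutator], so commutator lemmas transfer
    along [val_inj]. *)
Lemma lie_bracketC A B : lie_bracket A B = - lie_bracket B A.
Proof. by apply/val_inj; exact: commutatorN. Qed.

Lemma lie_bracketBl A B C :
  lie_bracket (A - B) C = lie_bracket A C - lie_bracket B C.
Proof.
rewrite lie_bracketC !(lie_bracketC _ C) -opprD; congr (- _).
apply/val_inj; exact: (commutatorBr (vectorField_val C : {additive _ -> _})).
Qed.

Lemma lie_bracket_jacobi A B C :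
  cyclic_sum3 (fun A B C => lie_bracket (lie_bracket A B) C) A B C = 0.
Proof.
(* Starting at [C] matches the goal term by term, as [[A,B],C] = -[C,[A,B]]. *)
have J : cyclic_sum3 (fun A B C => lie_bracket A (lie_bracket B C)) C A B = 0.
  apply/val_inj; exact: (@commutator_jacobi (smoothFun M)
    (vectorField_val C) (vectorField_val A) (vectorField_val B)).
by rewrite /cyclic_sum3 !(lie_bracketC (lie_bracket _ _)) -!opprD [X in - X]J oppr0.
Qed.

Lemma curvatureE A B : curvature nabla A B =
  commutator (nabla A) (nabla B) - nabla (lie_bracket A B).
Proof. by []. Qed.

Lemma curvatureC A B : curvature nabla A B = - curvature nabla B A.
Proof.
rewrite !curvatureE opprB commutatorN (lie_bracketC A) -(sub0r (lie_bracket B A)).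
by rewrite covBl cov0l sub0r opprK addrC.
Qed.

Lemma curvatureBl A B C :
  curvature nabla (A - B) C = curvature nabla A C - curvature nabla B C.
Proof.
rewrite !curvatureE lie_bracketBl !covBl !(commutatorN (nabla C)) commutatorBr.
by rewrite !opprD addrACA.
Qed.

Lemma cov_curvatureE A B C : cov_curvature nabla A B C =
  commutator (nabla A) (curvature nabla B C)
  - curvature nabla (nabla A B) C - curvature nabla B (nabla A C).
Proof. by []. Qed.

Lemma second_bianchi A B C :
  cyclic_sum3 (fun A B C =>
    cov_curvature nabla A B C + curvature nabla (torsion nabla A B) C) A B C
  = 0.
Proof.
pose J A B C : vectorField M -> vectorField M :=
  commutator (nabla A) (commutator (nabla B) (nabla C)).
pose L A B C : vectorField M -> vectorField M :=
  nabla (lie_bracket (lie_bracket A B) C).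
pose H A B C : vectorField M -> vectorField M :=
  commutator (nabla C) (nabla (lie_bracket A B)).
pose K A B C : vectorField M -> vectorField M := - curvature nabla B (nabla A C).
(* Expanding the torsion cancels the curvature of ([nabla X Y], [Z]). The rest is [J] and [L], whose
   cyclic sums vanish by Jacobi for operators and for Lie brackets, plus two differences that
   telescope. *)
have E X Y Z :
    cov_curvature nabla X Y Z + curvature nabla (torsion nabla X Y) Z =
    J X Y Z + L X Y Z + ((H X Y Z - H Y Z X) + (K X Y Z - K Y Z X)).
  rewrite cov_curvatureE /torsion !curvatureBl (curvatureE Y Z) commutatorBr.
  rewrite (curvatureE (lie_bracket _ _)) (curvatureC (nabla Y X)) -/(J X Y Z).
  rewrite -/(L X Y Z) -/(H Y Z X) -/(K X Y Z) -/(K Y Z X).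
  rewrite (commutatorN (nabla Z) (nabla (lie_bracket X Y))) -/(H X Y Z).
  move: (J X Y Z) (L X Y Z) (H X Y Z) (H Y Z X) (K X Y Z) (K Y Z X).
  move: (curvature _ _ _) => p j l h h' k k'.
  rewrite opprD !opprK (addrAC (j - h')) !addrA subrK.
  by rewrite [LHS](ACl (1*6*5*2*3*4)).
rewrite (eq_cyclic_sum3 _ _ _ E) cyclic_sum3D [X in _ + X]cyclic_sum3D.
rewrite !cyclic_sum3_rotB !addr0 cyclic_sum3D.
have -> : cyclic_sum3 J A B C = 0 by exact: (commutator_jacobi (nabla A)).
(* Additivity in the direction gathers the [L] terms into [nabla] along the Jacobi sum of
   brackets. *)
by rewrite add0r /cyclic_sum3 /L -!covDl [X in nabla X]lie_bracket_jacobi cov0l.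
Qed.

End second_bianchi.

(** * The identity for four vector fields *)

Theorem mainTheorem2 (R : realType) (n : nat) (M : smoothManifold R n)
    (nabla : affineConnection M) (A B C D : vectorField M) :
  cyclic_sum4 (fun A B C D : vectorField M =>
      cov_curvature nabla (lie_bracket A B) C D
    + cov_curvature nabla A B (lie_bracket C D)
    + cov_curvature nabla A (lie_bracket B C) D
    - curvature nabla A (torsion nabla B (lie_bracket C D))
    - curvature nabla A (torsion nabla (lie_bracket B C) D)
    + curvature nabla (torsion nabla A B) (lie_bracket C D)) A B C D
  = 0 :> (vectorField M -> vectorField M).
Proof.
pose f1 A B C D := cov_curvature nabla (lie_bracket A B) C D.
pose f2 A B C D := cov_curvature nabla A B (lie_bracket C D).
pose f3 A B C D := cov_curvature nabla A (lie_bracket B C) D.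
pose f4 A B C D := - curvature nabla A (torsion nabla B (lie_bracket C D)).
pose f5 A B C D := - curvature nabla A (torsion nabla (lie_bracket B C) D).
pose f6 A B C D := curvature nabla (torsion nabla A B) (lie_bracket C D).
(* The rotations bring every inner bracket to [A,B]; the three groups are then the three terms of
   the Bianchi sum of ([A,B],C,D). *)
transitivity (cyclic_sum4 (fun A B C D =>
    (f1 A B C D + f5 D A B C) + (f2 C D A B + f6 C D A B)
    + (f3 D A B C + f4 C D A B)) A B C D); last first.
  rewrite (eq_cyclic_sum4 (G := fun _ _ _ _ => 0)).
    by rewrite /cyclic_sum4 !addr0.
  (* Antisymmetry absorbs the minus signs and moves the torsion to the first slot. *)
  move=> X Y Z W; rewrite /f4 /f5 -!curvatureC.
  exact: (second_bianchi nabla (lie_bracket X Y) Z W).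
transitivity (cyclic_sum4 f1 A B C D + cyclic_sum4 f2 A B C D
    + cyclic_sum4 f3 A B C D + cyclic_sum4 f4 A B C D
    + cyclic_sum4 f5 A B C D + cyclic_sum4 f6 A B C D).
  by rewrite -!cyclic_sum4D.
rewrite -(cyclic_sum4_rot2 f2) -(cyclic_sum4_rot3 f3) -(cyclic_sum4_rot2 f4).
rewrite -(cyclic_sum4_rot3 f5) -(cyclic_sum4_rot2 f6).
by rewrite [LHS](ACl ((1*5)*(2*6)*(3*4)))/= -!cyclic_sum4D.
Qed.
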